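(* Let $G$ be a commutative grammar in normal form with $N$ non-terminals over an alphabet $\Sigma$ of size $A$, and let $R$ be a run of $G$. Put $\Gamma_G^{M}=M+1$ if $G$ is regular and $\Gamma_G^M=2^{M+1}$ otherwise, $H_A(C)=A!\,C^A$, and $$B_G=\Gamma_G^{N^2}+\left(2\Gamma_G^{N}\right)^{1+A}H_A\!\left(\Gamma_G^{N}\right).$$ Then there are a run $R_1$, finitely many simple cycles $C_k$ and numbers $n_k\in\mathbb{N}$ such that $$\Psi(R)=\Psi(R_1)+\sum_k n_k\Psi(C_k),$$ where $|R_1|\le B_G$, each $C_k$ is a simple cycle from some $q\in\mathrm{supp}(R_1)$, and the vectors $\Psi(C_k)$ are linearly independent.
   Context: For a finite set $X$ and $v\in\mathbb{R}^X$ let $|v|=\sum_{x\in X}|v_x|$. Elements of $\mathbb{N}^X$ are viewed as multisets over $X$; $[x]\in\mathbb{N}^X$ denotes the singleton multiset of $x$; $x\in s$ for a multiset $s$ means $s_x>0$. A commutative grammar is a tuple $G=(\Sigma,Q,q_I,\delta)$ where $\Sigma$ is a finite alphabet of terminal symbols, $Q$ is a finite set of non-terminal symbols, $q_I\in Q$ is the initial non-terminal, and $\delta\subseteq Q\times\mathbb{Z}^\Sigma\times\mathbb{N}^Q$ is a finite set of transitions. For a transition $d=(q,a,t)$ write $\mathrm{source}(d)=q$, $\Psi(d)=a$, $\mathrm{target}(d)=t$. $G$ is in normal form iff every transition $(q,a,t)$ satisfies $|t|\le 2$ and $|a|\le 1$; it is regular iff every transition satisfies $|t|\le1$ and $|a|\le1$.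 For $R\in\mathbb{N}^\delta$ let $\mathrm{source}(R)=\sum_{d}R_d[\mathrm{source}(d)]$, $\Psi(R)=\sum_d R_d\Psi(d)$, $\mathrm{target}(R)=\sum_d R_d\,\mathrm{target}(d)$, and $\mathrm{supp}(R)=\{q\in Q:\mathrm{source}(R)_q>0\}$. Write $p\to_R q$ iff some $d\in\delta$ with $R_d>0$ has $\mathrm{source}(d)=p$ and $\mathrm{target}(d)(q)>0$; $\to_R^*$ is the reflexive transitive closure; for $s\in\mathbb{N}^Q$, $s\to_R^*q$ means $p\to_R^*q$ for some $p\in s$. $R$ is a (commutative) subrun from $s\in\mathbb{N}^Q$ to $t\in\mathbb{N}^Q$ iff $\mathrm{source}(R)-s=\mathrm{target}(R)-t$ and $s\to_R^*q$ for every $q\in\mathrm{source}(R)$. A run from $p$ is a subrun from $[p]$ to $0$; a cycle from $p$ is a subrun from $[p]$ to $[p]$. A cycle is simple iff it is not a sum of two smaller non-zero cycles. *)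

(* Defs.v *)
From mathcomp Require Export all_boot all_order all_algebra.
From mathcomp Require Export finmap.
Export GRing.Theory.

Set Implicit Arguments.
Unset Strict Implicit.
Unset Printing Implicit Defensive.

Local Open Scope ring_scope.

(* The number of elements, with multiplicity, of a multiset over [X]. *)
Definition msize (X : finType) (s : {ffun X -> nat}) : nat :=
  (\sum_x s x)%N.

Definition norm1 (X : finType) (v : {ffun X -> int}) : nat :=
  (\sum_x `|v x|)%N.

Definition msingle (X : finType) (x : X) : {ffun X -> nat} :=
  [ffun y => nat_of_bool (y == x)].

Notation transition Sigma Q :=
  (Q * {ffun Sigma -> int} * {ffun Q -> nat})%type.

Record grammar (Sigma Q : finType) := Grammar {
  initial : Q;
  delta : {fset transition Sigma Q}
}.

Section Grammar.
Variables (Sigma Q : finType) (G : grammar Sigma Q).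

Definition tsource (d : delta G) : Q := (val d).1.1.
Definition tPsi (d : delta G) : {ffun Sigma -> int} := (val d).1.2.
Definition ttarget (d : delta G) : {ffun Q -> nat} := (val d).2.

Definition normal_form : bool :=
  [forall d : delta G, (msize (ttarget d) <= 2)%N && (norm1 (tPsi d) <= 1)%N].

Definition regular : bool :=
  [forall d : delta G, (msize (ttarget d) <= 1)%N && (norm1 (tPsi d) <= 1)%N].

Implicit Types (R C : {ffun delta G -> nat}) (s t : {ffun Q -> nat}).

Definition source R : {ffun Q -> nat} := \sum_d msingle (tsource d) *+ R d.
Definition Psi R : {ffun Sigma -> int} := \sum_d tPsi d *+ R d.
Definition target R : {ffun Q -> nat} := \sum_d ttarget d *+ R d.

Definition rsupp R : {set Q} := [set q | (0 < source R q)%N].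

Definition step R : rel Q := fun p q =>
  [exists d : delta G,
    [&& (0 < R d)%N, tsource d == p & (0 < ttarget d q)%N]].

Definition reach R s (q : Q) : Prop :=
  exists2 p, (0 < s p)%N & connect (step R) p q.

(* The balance equation is an equality of integer vectors, as subtraction on
   [nat] is truncated. *)
Definition subrun s t R : Prop :=
  (forall q, (source R q)%:Z - (s q)%:Z = (target R q)%:Z - (t q)%:Z) /\
  (forall q, (0 < source R q)%N -> reach R s q).

Definition run_from (p : Q) R : Prop := subrun (msingle p) 0 R.
Definition cycle_from (p : Q) C : Prop := subrun (msingle p) (msingle p) C.

(* The two summands may be cycles from non-terminals other than that of [C]; as
   they are nonzero, each of them is strictly smaller than [C]. *)
Definition is_simple C : Prop :=
  ~ exists C1 C2 : {ffun delta G -> nat},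
      [/\ C1 != 0, C2 != 0, exists p1, cycle_from p1 C1,
          exists p2, cycle_from p2 C2 & C = C1 + C2].

Definition simple_cycle_from (p : Q) C : Prop := cycle_from p C /\ is_simple C.

(* [M] is an index, not an exponent. *)
Definition Gamma (M : nat) : nat :=
  (if regular then M + 1 else 2 ^ (M + 1))%N.

Definition HA (A C : nat) : nat := (A`! * C ^ A)%N.

Definition bound : nat :=
  let N := #|Q| in
  let A := #|Sigma| in
  (Gamma (N ^ 2) + (2 * Gamma N) ^ (1 + A) * HA A (Gamma N))%N.

End Grammar.

(* Integer vectors are linearly independent over the reals if and only if they
   are over the rationals. *)
Definition ratvec (X : finType) (v : {ffun X -> int}) : {ffun X -> rat^o} :=
  [ffun x => (v x)%:~R].

Definition lin_indep (X : finType) (m : nat) (v : 'I_m -> {ffun X -> int}) :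
  bool := free [seq ratvec (v k) | k <- enum 'I_m].

(* Main.v *)
Require Import Defs.
From mathcomp Require Import all_boot all_order all_algebra finmap.
From mathcomp Require Import perm zify.
From Stdlib Require Import Classical.

(* Call a vector D balanced if source D = target D.  Cycles are balanced, and a
   balanced vector that is minimal among the nonzero ones turns out to be a simple
   cycle.  A run unfolds into a derivation
   tree. Cutting the tree between two occurrences of a non-terminal, as long as no
   non-terminal disappears, yields a run R0 with the support of R, of size at most
   Gamma^(N^2), such that R - R0 is balanced, hence a sum of minimal balanced
   vectors, all of which can be attached to R0.  Such a vector consists of a
   directed loop of at most N transitions and of at most N trees without
   repetitions along branches, so its size is at most S = N 2^N (N if G is
   regular).

   The multiplicities of these cycles are then changed in two steps that preserve
   the total image under Psi.  Two sets of cycles with the same total image can be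
   traded for each other until only K cycles are used, where
   2^K <= (2 K S + 1)^A.  Then integer relations with coefficients at most H_A(S),
   given by Cramer's rule, are subtracted until the cycles of multiplicity at least
   H_A(S) have linearly independent images.  The others, of total size at most
   K S H_A(S), are merged into R0.  As S may exceed Gamma^N, it is the logarithmic
   size of K that makes the bound B_G hold. *)

Set Implicit Arguments.
Unset Strict Implicit.
Unset Printing Implicit Defensive.

Import Order.TTheory Num.Theory.

(** * Arithmetic of the bound *)

(** The summand 1 is there for [L = 3]. *)
Lemma sqr_le_exp2 L : (L ^ 2 <= 2 ^ L + 1)%N.
Proof.
case: (leqP L 3) => [|L4]; first by case: L => [|[|[|[|]]]].
elim: L L4 => // L IH; rewrite ltnS leq_eqVlt => /orP[/eqP<-//|L4].
by have := IH L4; rewrite [(2 ^ L.+1)%N]expnS; nia.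
Qed.

(** With [L] the integer part of the binary logarithm of [K], [b ^ A] is less than 2 to the power
    [L.+1 * (e * A)], and this exponent is at most [L ^ 2 - 1 <= 2 ^ L <= K]. *)
Lemma exp_lt_exp2 K b e A : (b <= K ^ e)%N -> (2 ^ (e * A + 1) < K)%N ->
  (0 < e * A)%N -> (b ^ A < 2 ^ K)%N.
Proof.
move=> bK eK eA0; have K0 : (0 < K)%N by apply: leq_trans eK.
pose L := trunc_log 2 K.
have /andP[LK KL] := trunc_log_bounds (ltnSn 1) K0.
have eL : (e * A + 1 <= L)%N by apply: trunc_log_max => //; apply: ltnW.
apply: leq_ltn_trans (_ : K ^ (e * A) < _)%N.
  by rewrite expnM; case: (A) => [|a]; rewrite ?expn0 ?leq_exp2r.
apply: leq_trans (_ : (2 ^ L.+1) ^ (e * A) <= _)%N.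
  by rewrite ltn_exp2r.
rewrite -expnM leq_exp2l //; apply: leq_trans LK.
by have := sqr_le_exp2 L; rewrite -/L; nia.
Qed.

Lemma exp5_le_exp2 N : (N ^ 5 <= 2 ^ 9 * 2 ^ N)%N.
Proof.
case: (leqP N 7) => [|N7]; first by case: N => [|[|[|[|[|[|[|[|]]]]]]]].
elim: N N7 => // N IH; rewrite ltnS leq_eqVlt => /orP[/eqP<-|N7]; first by vm_compute.
have := IH N7; rewrite [(2 ^ N.+1)%N]expnS.
(* As [N >= 8], the quotient of the two fifth powers is at most (9/8)^5, which is less than 2. *)
suff : (N.+1 ^ 5 <= 2 * N ^ 5)%N by nia.
have -> : N = ((N - 8) + 8)%N by lia.
by set m := (N - 8)%N; nia.
Qed.

(** For large [K] the base [2 * K * N + 1] is at most [K ^ 2], so the hypothesis bounds [K]; for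
    [A = 0] it forces [K = 0]. *)
Lemma pigeonhole_bound_regular K A N : (0 < N)%N ->
  (2 ^ K <= (2 * K * N + 1) ^ A)%N ->
  (K * N ^ A.+1 <= (2 * (N + 1)) ^ A.+1 * (N + 1) ^ A)%N.
Proof.
move=> N0; case: A => [|A] le.
  by case: K le => // K; rewrite expn0 expnS; have := expn_gt0 2 K; lia.
suff leK : (K <= 2 ^ A.+2 * (N + 1) ^ A.+1)%N.
  rewrite expnMn mulnAC leq_mul // leq_exp2r //; lia.
rewrite leqNgt; apply/negP => gt.
have g2 : (2 ^ A.+1 <= (N + 1) ^ A.+1)%N by rewrite leq_exp2r //; lia.
have g1 : (4 * (N + 1) <= K)%N.
  apply: leq_trans (ltnW gt); rewrite [(2 ^ A.+2)%N]expnS expnS [((N+1)^A.+1)%N]expnS.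
  by have := expn_gt0 2 A; have := expn_gt0 (N + 1) A; rewrite addn1 /=; nia.
have : ((2 * K * N + 1) ^ A.+1 < 2 ^ K)%N.
  apply: (@exp_lt_exp2 K _ 2); [nia| |lia].
  apply: leq_ltn_trans gt.
  rewrite [X in (_ <= X * _)%N](_ : _ = 2 ^ A.+1 * 2)%N; last by rewrite expnS mulnC.
  have -> : (2 * A.+1 + 1 = A.+1 + A.+1 + 1)%N by lia.
  by rewrite !expnD expn1; nia.
by rewrite ltnNge le.
Qed.

Lemma pigeonhole_bound K A N : (0 < N)%N ->
  (2 ^ K <= (2 * K * (N * 2 ^ N) + 1) ^ A)%N ->
  (K * (N * 2 ^ N) ^ A.+1 <= (2 * 2 ^ (N + 1)) ^ A.+1 * (2 ^ (N + 1)) ^ A)%N.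
Proof.
move=> N0; case: A => [|A] le.
  by case: K le => // K; rewrite expn0 expnS; have := expn_gt0 2 K; lia.
(* The exponent is exactly what the right-hand side leaves once [N ^ A] is bounded by
   [2 ^ (N * A)]. *)
suff leK : (K * N ^ 2 <= 2 ^ (N + 3 * A.+1 + 2))%N.
  have NA : (N ^ A <= 2 ^ (N * A))%N.
    by rewrite expnM; case: (A) => // a; rewrite leq_exp2r // ltnW // ltn_expl.
  have := leq_mul leK NA; rewrite -expnD => le2.
  have -> : (K * (N * 2 ^ N) ^ A.+2 = (K * N ^ 2 * N ^ A) * 2 ^ (N * A.+2))%N.
    by rewrite expnMn -expnM -[A.+2]addn2 expnD; lia.
  rewrite -expnS -!expnM -expnD; apply: leq_trans (leq_mul le2 (leqnn _)) _.
  by rewrite -expnD leq_exp2l //; lia.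
rewrite leqNgt; apply/negP => gt.
have N2 : (N ^ 2 <= 2 ^ (N + 1))%N.
  have := sqr_le_exp2 N; rewrite [(2 ^ (N + 1))%N]expnD expn1.
  by have := expn_gt0 2 N; lia.
have N5 := exp5_le_exp2 N.
have P0 : (0 < 2 ^ N)%N by rewrite expn_gt0.
have gt5 : (2 ^ 5 * 2 ^ N < K * N ^ 2)%N.
  by apply: leq_ltn_trans gt; rewrite -expnD leq_exp2l //; lia.
have K3 : (2 ^ (3 * A.+1 + 1) < K)%N.
  rewrite -(ltn_pmul2r P0) -(ltn_pmul2r (ltn0Sn 1)); move: gt.
  have -> : (N + 3 * A.+1 + 2 = (3 * A.+1 + 1) + (N + 1))%N by lia.
  rewrite expnD => gt; rewrite -mulnA -[X in (_ * X < _)%N]/(2 ^ N * 2 ^ 1)%N -expnD.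
  apply: leq_trans gt _; rewrite -mulnA -[X in (_ <= _ * X)%N]/(2 ^ N * 2 ^ 1)%N -expnD.
  by rewrite leq_mul2l N2 orbT.
have N3 : (N ^ 3 < 16 * K)%N.
  have : (N ^ 3 * N ^ 2 < 16 * K * N ^ 2)%N by rewrite -expnD; lia.
  by rewrite ltn_pmul2r // expn_gt0 N0.
(* [gt5] and [N3] bound the base by [K ^ 3]. *)
have : ((2 * K * (N * 2 ^ N) + 1) ^ A.+1 < 2 ^ K)%N.
  apply: (@exp_lt_exp2 K _ 3) => //.
  have h1 : (32 * (N * 2 ^ N) <= K * N ^ 3)%N.
    have := ltnW gt5; rewrite -(leq_pmul2r N0); lia.
  have h2 : (32 * (K * (N * 2 ^ N)) <= K * K * N ^ 3)%N by nia.
  have K0 : (0 < K)%N by apply: leq_trans K3.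
  have h3 : (K * K * N ^ 3 < K * K * (16 * K))%N by rewrite ltn_pmul2l // muln_gt0 K0.
  by rewrite !expnS expn0; lia.
by rewrite ltnNge le.
Qed.

Local Open Scope ring_scope.

(** * Multisets and flows *)

Section Multiset.
Variable X : finType.
Implicit Types s t : {ffun X -> nat}.

Lemma maddE s t x : (s + t) x = (s x + t x)%N.
Proof. by rewrite ffunE. Qed.

Lemma m0E x : (0 : {ffun X -> nat}) x = 0%N.
Proof. by rewrite ffunE. Qed.

Lemma msingleE (x y : X) : msingle x y = nat_of_bool (y == x).
Proof. by rewrite ffunE. Qed.

Lemma maddI s : injective (+%R s).
Proof.
move=> t u /ffunP e; apply/ffunP => x.
by have := e x; rewrite !maddE => /addnI.
Qed.

Lemma madd_eq0 s t : s + t = 0 -> s = 0 /\ t = 0.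
Proof.
move=> /ffunP e; split; apply/ffunP => x; have := e x; rewrite maddE !m0E; lia.
Qed.

Lemma msizeD s t : msize (s + t) = (msize s + msize t)%N.
Proof. by rewrite -big_split; apply: eq_bigr => x _; rewrite maddE. Qed.

Lemma msize0 : @msize X 0 = 0%N.
Proof. by rewrite /msize big1 // => x _; rewrite m0E. Qed.

Lemma msize1 (x : X) : msize (msingle x) = 1%N.
Proof.
rewrite /msize (bigD1 x) //= msingleE eqxx big1 // => y /negbTE.
by rewrite msingleE => ->.
Qed.

Lemma msize_eq0 s : msize s = 0%N -> s = 0.
Proof.
move=> /eqP; rewrite sum_nat_eq0 => /forallP e; apply/ffunP => x.
by rewrite m0E; apply/eqP/e.
Qed.

Lemma msizeMn s n : msize (s *+ n) = (msize s * n)%N.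
Proof.
by elim: n => [|n IH]; rewrite ?mulr0n ?msize0 ?muln0 // mulrS msizeD IH mulnS.
Qed.

Lemma msize_sum (I : Type) (r : seq I) (P : pred I) (f : I -> {ffun X -> nat}) :
  msize (\sum_(i <- r | P i) f i) = (\sum_(i <- r | P i) msize (f i))%N.
Proof. by apply: (big_morph _ msizeD msize0). Qed.

Lemma mneq0 s : s != 0 -> exists x, (0 < s x)%N.
Proof.
move=> s0; apply/existsP; apply: contraR s0 => /existsPn e.
by apply/eqP/ffunP => x; rewrite m0E; apply/eqP; rewrite -leqn0 leqNgt.
Qed.

Lemma mpick s x : (0 < s x)%N -> exists t, s = msingle x + t.
Proof.
move=> sx; exists [ffun y => s y - (y == x)]%N; apply/ffunP => y.
by rewrite maddE msingleE ffunE; case: eqP => [->|]; lia.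
Qed.

Lemma msize_le2 s : (msize s <= 2)%N ->
  [\/ s = 0, exists q, s = msingle q | exists q r, s = msingle q + msingle r].
Proof.
move=> s2; have [->|/mneq0[q /mpick[t def_s]]] := eqVneq s 0.
  exact: Or31.
have [t0|/mneq0[r /mpick[u def_t]]] := eqVneq t 0.
  by apply: Or32; exists q; rewrite def_s t0 addr0.
apply: Or33; exists q, r; rewrite def_s def_t; congr (_ + _).
rewrite (_ : u = 0) ?addr0 //; apply: msize_eq0.
by move: s2; rewrite def_s def_t !msizeD !msize1; lia.
Qed.

End Multiset.

Section Flow.
Variables (Sigma Q : finType) (G : grammar Sigma Q).
Implicit Types (R C F : {ffun delta G -> nat}) (s : {ffun Q -> nat}).
Implicit Type d : delta G.

Lemma sourceD R C : source (R + C) = source R + source C.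
Proof.
rewrite -big_split; apply: eq_bigr => d _ /=.
by rewrite maddE mulrnDr.
Qed.

Lemma targetD R C : target (R + C) = target R + target C.
Proof.
rewrite -big_split; apply: eq_bigr => d _ /=.
by rewrite maddE mulrnDr.
Qed.

Lemma PsiD R C : Psi (R + C) = Psi R + Psi C.
Proof.
rewrite -big_split; apply: eq_bigr => d _ /=.
by rewrite maddE mulrnDr.
Qed.

Lemma source0 : source (0 : {ffun delta G -> nat}) = 0.
Proof. by rewrite /source big1 // => d _; rewrite m0E mulr0n. Qed.

Lemma target0 : target (0 : {ffun delta G -> nat}) = 0.
Proof. by rewrite /target big1 // => d _; rewrite m0E mulr0n. Qed.

Lemma Psi0 : Psi (0 : {ffun delta G -> nat}) = 0.
Proof. by rewrite /Psi big1 // => d _; rewrite m0E mulr0n. Qed.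

Lemma source_sum (I : Type) (r : seq I) (P : pred I) (f : I -> {ffun delta G -> nat}) :
  source (\sum_(i <- r | P i) f i) = \sum_(i <- r | P i) source (f i).
Proof. exact: (big_morph _ sourceD source0). Qed.

Lemma target_sum (I : Type) (r : seq I) (P : pred I) (f : I -> {ffun delta G -> nat}) :
  target (\sum_(i <- r | P i) f i) = \sum_(i <- r | P i) target (f i).
Proof. exact: (big_morph _ targetD target0). Qed.

Lemma Psi_sum (I : Type) (r : seq I) (P : pred I) (f : I -> {ffun delta G -> nat}) :
  Psi (\sum_(i <- r | P i) f i) = \sum_(i <- r | P i) Psi (f i).
Proof. exact: (big_morph _ PsiD Psi0). Qed.

Lemma source1 d : source (msingle d) = msingle (tsource d).
Proof.
rewrite /source (bigD1 d) //= msingleE eqxx mulr1n big1 ?addr0 // => e /negbTE.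
by rewrite msingleE => ->; rewrite mulr0n.
Qed.

Lemma target1 d : target (msingle d) = ttarget d.
Proof.
rewrite /target (bigD1 d) //= msingleE eqxx mulr1n big1 ?addr0 // => e /negbTE.
by rewrite msingleE => ->; rewrite mulr0n.
Qed.

Lemma source_gt0 R q :
  (0 < source R q)%N <-> exists2 d, (0 < R d)%N & tsource d = q.
Proof.
split=> [|[d /mpick[F ->] <-]]; last first.
  by rewrite sourceD source1 maddE msingleE eqxx.
rewrite /source sum_ffunE.
have [/existsP[d /andP[Rd /eqP dq]] _|/existsPn e] :=
    boolP [exists d, (0 < R d)%N && (tsource d == q)]; first by exists d.
rewrite big1 // => d _; rewrite ffunMnE msingleE; have := e d.
rewrite eq_sym; case: eqP => /= [_|]; first by rewrite andbT lt0n negbK => /eqP->.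
by rewrite mul0rn.
Qed.

Lemma target_gt0 R q :
  (0 < target R q)%N -> exists2 d, (0 < R d)%N & (0 < ttarget d q)%N.
Proof.
rewrite /target sum_ffunE.
have [/existsP[d /andP[Rd dq]] _|/existsPn e] :=
    boolP [exists d, (0 < R d)%N && (0 < ttarget d q)%N]; first by exists d.
rewrite big1 // => d _; rewrite ffunMnE; have := e d.
rewrite negb_and -!leqNgt !leqn0 => /orP[] /eqP->; first by rewrite mulr0n.
by rewrite mul0rn.
Qed.

(** Every transition has exactly one source. *)
Lemma msize_source R : msize (source R) = msize R.
Proof.
rewrite msize_sum; apply: eq_bigr => d _.
by rewrite msizeMn msize1 mul1n.
Qed.

Lemma source_eq0 R : source R = 0 -> R = 0.
Proof. by move=> e; apply: msize_eq0; rewrite -msize_source e msize0. Qed.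

Lemma in_rsupp R q : (q \in rsupp R) = (0 < source R q)%N.
Proof. by rewrite inE. Qed.

Lemma rsuppD R C : rsupp (R + C) = rsupp R :|: rsupp C.
Proof. by apply/setP => q; rewrite !inE sourceD maddE addn_gt0. Qed.

(** The balance equation of a subrun from [s] to 0, written with additions only so that it can be
    stated over the naturals. *)
Definition flow F s := source F = target F + s.

Definition reachable F s := forall q, (0 < source F q)%N -> reach F s q.

Lemma subrun_flow p R : run_from p R <-> flow R (msingle p) /\ reachable R (msingle p).
Proof.
split=> [[e r]|[e r]]; split=> //.
  apply/ffunP => q; have := e q; rewrite maddE m0E; lia.
move=> q; move/ffunP: e => /(_ q); rewrite maddE m0E; lia.
Qed.

Lemma stepP F p q : reflect
  (exists d, [/\ (0 < F d)%N, tsource d = p & (0 < ttarget d q)%N]) (step F p q).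
Proof.
apply: (iffP existsP) => [[d /and3P[? /eqP ? ?]]|[d [? ? ?]]]; exists d => //.
by apply/and3P; split=> //; apply/eqP.
Qed.

Lemma step_addl F F' p q : step F p q -> step (F + F') p q.
Proof.
move=> /stepP[d [Fd ? ?]]; apply/stepP; exists d; split=> //.
by rewrite maddE ltn_addr.
Qed.

Lemma connect_addl F F' p q : connect (step F) p q -> connect (step (F + F')) p q.
Proof.
by apply: connect_sub => x y /(@step_addl _ F'); apply: connect1.
Qed.

Lemma connect_ind (T : finType) (e : rel T) (P : T -> Prop) x y :
  (forall a b, P a -> e a b -> P b) -> connect e x y -> P x -> P y.
Proof.
move=> clP /connectP[p]; elim: p x => [|z p IH] x /= => [_ -> //|].
by case/andP=> exz pzp def_y Px; apply: (IH z) => //; apply: clP exz.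
Qed.

(* If [p] lies on a directed cycle of [F], the transition fired at [p] is taken
   on such a cycle, so that [p] stays reachable. *)
Lemma fire F s p : flow F (msingle p + s) ->
  exists d F1, [/\ F = msingle d + F1, tsource d = p &
    reachable F (msingle p + s) -> reachable F1 (s + ttarget d)].
Proof.
move=> flF.
pose cyc d := [&& (0 < F d)%N, tsource d == p &
  [exists y, (0 < ttarget d y)%N && connect (step F) y p]].
(* A step that uses [d] lands in [ttarget d], which is available after firing; any other transition
   of [F] survives in [F1]. *)
have mono d F1 : F = msingle d + F1 -> forall a b,
    reach F1 (s + ttarget d) a -> step F a b -> reach F1 (s + ttarget d) b.
  move=> defF a b [c sc cca] /stepP[d' [Fd' d'a d'b]].
  move: Fd'; rewrite defF maddE msingleE; case: eqP => [d'd _|_ /= Fd'].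
    by exists b => //; rewrite maddE -d'd ltn_addl.
  exists c => //; apply: (connect_trans cca); apply: connect1.
  by apply/stepP; exists d'.
have clos d F1 : F = msingle d + F1 -> forall a b,
    connect (step F) a b -> reach F1 (s + ttarget d) a ->
    reach F1 (s + ttarget d) b.
  by move=> defF a b cab; apply: connect_ind cab => a' b'; apply: mono.
have start (t : {ffun Q -> nat}) q : (0 < (s + t)%R q)%N -> forall F', reach F' (s + t) q.
  by move=> sq F'; exists q.
have [/existsP[d /and3P[Fd /eqP dp /existsP[y /andP[dy yp]]]]|/existsPn nocyc] :=
    boolP [exists d, cyc d].
  have [F1 defF] := mpick Fd; exists d, F1; split=> // rF q Fq.
  have [|c sc cq] := rF q; first by rewrite defF sourceD maddE ltn_addl.
  apply: (clos _ _ defF _ _ cq).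
  move: sc; rewrite maddE msingleE; case: eqP => [-> _|_ /= sc].
    by apply: (clos _ _ defF _ _ yp); apply: start; rewrite maddE ltn_addl.
  by apply: start; rewrite maddE ltn_addr.
(* Without a directed cycle through [p], any transition with source [p] may be fired. *)
have: (0 < source F p)%N by rewrite flF !maddE msingleE eqxx; lia.
case/source_gt0=> d Fd dp; have [F1 defF] := mpick Fd.
exists d, F1; split=> // rF q Fq.
have [|c sc cq] := rF q; first by rewrite defF sourceD maddE ltn_addl.
move: (sc); rewrite maddE msingleE; case: eqP => [cp _|_ /= sc']; last first.
  by apply: (clos _ _ defF _ _ cq); apply: start; rewrite maddE ltn_addr.
rewrite {c}cp in sc cq.
have fl1 : flow F1 (s + ttarget d).
  move: flF; rewrite /flow defF sourceD targetD source1 target1 dp => flF.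
  by apply: (@maddI _ (msingle p)); rewrite flF addrC -!addrA; congr (_ + _);
     rewrite addrA addrC; congr (_ + _); rewrite addrC.
(* If [p] is no longer a source in [F1], a path leaving [p] starts with [d], so its second vertex is
   in [ttarget d]. *)
have [F1p|F1p] := posnP (source F1 p).
  case/connectP: cq => [[|y l]] /= => [_ qp|].
    by move: Fq; rewrite qp F1p.
  case/andP=> /stepP[d' [Fd' d'p d'y]] pl def_q.
  apply: (clos _ _ defF y); first by apply/connectP; exists l.
  apply: start; rewrite maddE; move: Fd'; rewrite defF maddE msingleE.
  case: eqP => [<- _|_ /= Fd']; first by rewrite ltn_addl.
  suff: (0 < source F1 p)%N by rewrite F1p.
  by apply/source_gt0; exists d'.
apply: (clos _ _ defF _ _ cq).
(* Either [p] is still available, or some [d'] in [F1] produces it; the source of [d'] is then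
   reached from [s], since reaching it from [p] would close a cycle. *)
have := F1p; rewrite fl1 maddE addn_gt0 => /orP[/target_gt0[d' F1d' d'p]|]; last first.
  by move=> ?; apply: start.
have Fd' : (0 < F d')%N by rewrite defF maddE ltn_addl.
have [|c' sc' cc] := rF (tsource d'); first by apply/source_gt0; exists d'.
have cp : connect (step F) c' p.
  by apply: (connect_trans cc); apply/connect1/stepP; exists d'.
apply: (clos _ _ defF _ _ cp); apply: start; move: sc'.
rewrite !maddE msingleE; case: eqP => [ecp _|_ /= sc2]; last by rewrite ltn_addr.
rewrite ecp in cc; case/connectP: cc => [[|y l]] /= => [_ ed|].
  by have /negP[] := nocyc d'; rewrite /cyc Fd' ed eqxx; apply/existsP; exists p;
     rewrite d'p /=.
case/andP=> /stepP[d2 [Fd2 d2p d2y]] pl def_d.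
have /negP[] := nocyc d2; rewrite /cyc Fd2 d2p eqxx /=; apply/existsP; exists y.
rewrite d2y /=; apply: (@connect_trans _ _ (tsource d')).
  by apply/connectP; exists l.
by apply/connect1/stepP; exists d'.
Qed.

End Flow.

(** * Derivation trees *)

Ltac madd := apply/ffunP => ?; rewrite ?maddE ?m0E; lia.

Section Tree.
Variables (Sigma Q : finType) (G : grammar Sigma Q).
Implicit Types (R C F : {ffun delta G -> nat}) (s : {ffun Q -> nat}).
Implicit Type d : delta G.

(** One constructor for each size that a target may have in normal form. *)
Inductive tree :=
  | T0 of delta G
  | T1 of delta G & tree
  | T2 of delta G & tree & tree.
Implicit Types t u x : tree.

Definition label t : Q :=
  match t with T0 d => tsource d | T1 d _ => tsource d | T2 d _ _ => tsource d end.

Fixpoint wf t : bool :=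
  match t with
  | T0 d => ttarget d == 0
  | T1 d a => (ttarget d == msingle (label a)) && wf a
  | T2 d a b => [&& ttarget d == msingle (label a) + msingle (label b), wf a & wf b]
  end.

Fixpoint vec t : {ffun delta G -> nat} :=
  match t with
  | T0 d => msingle d
  | T1 d a => msingle d + vec a
  | T2 d a b => msingle d + (vec a + vec b)
  end.

Fixpoint below u t : Prop :=
  match t with
  | T0 _ => False
  | T1 _ a => u = a \/ below u a
  | T2 _ a b => (u = a \/ below u a) \/ (u = b \/ below u b)
  end.

Definition occurs u t := u = t \/ below u t.

Lemma below_trans u x t : below u x -> below x t -> below u t.
Proof.
move=> ux; elim: t => [//|d a IH|d a IHa b IHb] /=.
  by case=> [<-|/IH]; right.
by case=> [[<-|/IHa]|[<-|/IHb]]; [left|left|right|right]; right.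
Qed.

Lemma below_wf u t : below u t -> wf t -> wf u.
Proof.
elim: t => [//|d a IH|d a IHa b IHb] /=.
  by case=> [->|/IH wu] /andP[].
by case=> [[->|/IHa wu]|[->|/IHb wu]] /and3P[_ wa wb] //; apply: wu.
Qed.

(** The remainder contains the root transition of [t]. *)
Lemma below_vec u t : below u t -> exists2 w, w != 0 & vec t = vec u + w.
Proof.
have nz d F : msingle d + F != 0.
  by apply/eqP => /madd_eq0[/ffunP/(_ d)]; rewrite msingleE m0E eqxx.
elim: t => [//|d a IH|d a IHa b IHb] /=.
  by case=> [->|/IH[w _ ->]]; [exists (msingle d + 0)|exists (msingle d + w)];
     rewrite ?nz //; madd.
case=> [[->|/IHa[w _ ->]]|[->|/IHb[w _ ->]]].
- by exists (msingle d + vec b) => //; madd.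
- by exists (msingle d + (w + vec b)) => //; madd.
- by exists (msingle d + vec a) => //; madd.
- by exists (msingle d + (w + vec a)) => //; madd.
Qed.

Lemma occurs_vec u t : occurs u t -> exists w, vec t = vec u + w.
Proof.
by case=> [->|/below_vec[w _ ->]]; [exists 0; rewrite addr0|exists w].
Qed.

(** As [v] and [u] have the same label, [v] fits under the same transition. The effect on [vec] is
    stated without subtraction. *)
Lemma graft u t v : below u t -> wf t -> wf v -> label v = label u ->
  exists t', [/\ wf t', label t' = label t & vec t' + vec u = vec t + vec v].
Proof.
move=> + + wv rv; elim: t => [//|d a IH|d a IHa b IHb] /=.
  case=> [<-|/IH{}IH] /andP[da wa].
    by exists (T1 d v); rewrite /= rv da wv; split=> //; madd.
  have [a' [wa' ra' va']] := IH wa.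
  by exists (T1 d a'); rewrite /= ra' da wa'; split=> //; rewrite -!addrA va'.
case=> [[<-|/IHa{}IHa]|[<-|/IHb{}IHb]] /and3P[dab wa wb].
- by exists (T2 d v b); rewrite /= rv dab wv wb; split=> //; madd.
- have [a' [wa' ra' va']] := IHa wa.
  exists (T2 d a' b); rewrite /= ra' dab wa' wb; split=> //.
  by rewrite -!addrA; congr (_ + _); rewrite [vec b + _]addrC addrA va' addrAC addrA.
- by exists (T2 d a v); rewrite /= rv dab wa wv; split=> //; madd.
- have [b' [wb' rb' vb']] := IHb wb.
  exists (T2 d a b'); rewrite /= rb' dab wa wb'; split=> //.
  by rewrite -!addrA vb'.
Qed.

Lemma graft_occurs u t v : occurs u t -> wf t -> wf v -> label v = label u ->
  exists t', [/\ wf t', label t' = label t & vec t' + vec u = vec t + vec v].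
Proof.
case=> [-> wt wv rv|]; last exact: graft.
by exists v; split=> //; rewrite addrC.
Qed.

Lemma source_root t : (0 < source (vec t) (label t))%N.
Proof.
by case: t => [d|d a|d a b] /=; rewrite ?sourceD source1 ?maddE msingleE eqxx.
Qed.

Lemma tree_flow t : wf t -> flow (vec t) (msingle (label t)).
Proof.
rewrite /flow; elim: t => [d|d a IH|d a IHa b IHb] /=.
- by move/eqP=> e; rewrite source1 target1 e add0r.
- case/andP=> /eqP e /IH{}IH; rewrite !sourceD !targetD source1 target1 e IH.
  by rewrite addrC [target _ + _]addrC.
- case/and3P=> /eqP e /IHa{}IHa /IHb{}IHb.
  rewrite !sourceD !targetD source1 target1 e IHa IHb.
  rewrite [LHS]addrC; congr (_ + _).
  by rewrite addrACA addrC.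
Qed.

Lemma tree_reach t q : wf t -> (0 < source (vec t) q)%N ->
  connect (step (vec t)) (label t) q.
Proof.
have lift d a F :  (0 < ttarget d (label a))%N ->
    connect (step (vec a)) (label a) q ->
    connect (step (msingle d + (vec a + F))) (tsource d) q.
  move=> da aq; apply: (@connect_trans _ _ (label a)).
    apply/connect1/stepP; exists d; split=> //.
    by rewrite maddE msingleE eqxx.
  by rewrite addrCA; apply: connect_addl.
have here d F : (0 < msingle (tsource d) q)%N -> connect (step F) (tsource d) q.
  by rewrite msingleE; case: eqP => // ->; rewrite connect0.
elim: t => [d|d a IH|d a IHa b IHb] /=.
- by rewrite source1 => _; apply: here.
- case/andP=> /eqP e /IH{}IH; rewrite sourceD source1 maddE addn_gt0.
  case/orP=> [|/IH]; first exact: here.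
  move=> aq; have := lift d a 0; rewrite addr0; apply=> //.
  by rewrite e msingleE eqxx.
- case/and3P=> /eqP e /IHa{}IHa /IHb{}IHb; rewrite !sourceD source1 !maddE !addn_gt0.
  case/or3P=> [|/IHa aq|/IHb bq]; first exact: here.
    by apply: (lift d a (vec b)) => //; rewrite e maddE msingleE eqxx.
  rewrite [vec a + _]addrC; apply: (lift d b (vec a)) => //.
  by rewrite e maddE !msingleE eqxx addn1.
Qed.

(** * Forests of derivation trees *)

Definition labels (ts : seq tree) : {ffun Q -> nat} := \sum_(t <- ts) msingle (label t).
Definition vecs (ts : seq tree) : {ffun delta G -> nat} := \sum_(t <- ts) vec t.

Lemma labels_cons t ts : labels (t :: ts) = msingle (label t) + labels ts.
Proof. exact: big_cons. Qed.

Lemma vecs_cons t ts : vecs (t :: ts) = vec t + vecs ts.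
Proof. exact: big_cons. Qed.

Lemma labels_cat ts us : labels (ts ++ us) = labels ts + labels us.
Proof. exact: big_cat. Qed.

Lemma vecs_cat ts us : vecs (ts ++ us) = vecs ts + vecs us.
Proof. exact: big_cat. Qed.

Lemma forest_flow ts : all wf ts -> flow (vecs ts) (labels ts).
Proof.
elim: ts => [_|t ts IH]; first by rewrite /flow /vecs /labels !big_nil source0 target0 addr0.
case/andP=> /tree_flow; rewrite /flow => ft /IH{IH}.
rewrite /flow /vecs /labels !big_cons => fs.
by rewrite sourceD targetD ft fs addrACA.
Qed.

Lemma forest_pick ts q s : all wf ts -> labels ts = msingle q + s ->
  exists t ts', [/\ wf t, all wf ts', label t = q, labels ts' = s &
    vecs ts = vec t + vecs ts'].
Proof.
elim: ts s => [|t ts IH] s.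
  move=> _ /ffunP/(_ q); rewrite /labels big_nil maddE m0E msingleE eqxx.
  by [].
case/andP=> wt wts; rewrite {1}/labels big_cons -/(labels ts).
have [tq|tq] := eqVneq (label t) q.
  rewrite tq => /maddI e; exists t, ts; split=> //.
  by rewrite /vecs big_cons.
move=> e; have [s' def_s]: exists s', s = msingle (label t) + s'.
  apply: mpick; move/ffunP: e => /(_ (label t)).
  by rewrite !maddE !msingleE eqxx (negbTE tq); lia.
have [//||t' [ts' [wt' wts' rt' rts' vts']]] := IH s'.
  by apply: (@maddI _ (msingle (label t))); rewrite e def_s addrCA.
exists t', (t :: ts'); split=> //=; first by rewrite wt.
  by rewrite /labels big_cons -/(labels _) rts' def_s.
by rewrite /vecs !big_cons -!/(vecs _) vts' addrCA.
Qed.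

(** After firing a transition [d] at some [p], induction gives a forest for the rest; its trees
    rooted in [ttarget d] become the children of a tree with root transition [d]. The leftover [F']
    is what remains once no non-terminal is pending, and reachability excludes it. *)
Lemma forest_exists F s : normal_form G -> flow F s ->
  exists ts F', [/\ all wf ts, labels ts = s, F = vecs ts + F' &
    reachable F s -> F' = 0].
Proof.
move=> /forallP nf; elim: {F}(msize F).+1 {-2}F s (ltnSn (msize F)) => // n IH F s Fn fl.
have [->|/mneq0[p /mpick[s0 def_s]]] := eqVneq s 0.
  exists [::], F; split; rewrite ?/labels ?/vecs ?big_nil ?add0r // => r.
  apply: source_eq0; apply/ffunP => q; rewrite m0E; apply/eqP.
  rewrite -leqn0 leqNgt; apply/negP => /r[c].
  by rewrite m0E.
rewrite def_s in fl *; have [d [F1 [defF dp rF]]] := fire fl.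
have fl1 : flow F1 (s0 + ttarget d).
  move: fl; rewrite /flow defF sourceD targetD source1 target1 dp => fl.
  by apply: (@maddI _ (msingle p)); rewrite fl addrC -!addrA; congr (_ + _);
     rewrite addrA addrC; congr (_ + _); rewrite addrC.
have [|ts [F' [wts rts vts r]]] := IH F1 _ _ fl1.
  by move: Fn; rewrite defF msizeD msize1.
have /andP[/msize_le2 d2 _] := nf d.
suff [t [ts' [wt wts' rt rts' vt]]]: exists t ts', [/\ wf t, all wf ts', label t = p,
    labels ts' = s0 & msingle d + vecs ts = vec t + vecs ts'].
  exists (t :: ts'), F'; split=> [|||/rF/r//].
  - by rewrite /= wt.
  - by rewrite /labels big_cons -/(labels _) rts' rt.
  - by rewrite /vecs big_cons -/(vecs _) -vt defF vts addrA.
case: d2 => [d0|[q dq]|[q [q' dq]]].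
- by exists (T0 d), ts; rewrite /= d0; split=> //; rewrite rts d0 addr0.
- have [|a [ts' [wa wts' ra rts' va]]] := @forest_pick ts q s0 wts.
    by rewrite rts dq addrC.
  by exists (T1 d a), ts'; rewrite /= dq ra eqxx; split=> //; rewrite va addrA.
have [|a [ts1 [wa wts1 ra rts1 va]]] := @forest_pick ts q (msingle q' + s0) wts.
  by rewrite rts dq addrC addrA.
have [b [ts2 [wb wts2 rb rts2 vb]]] := forest_pick wts1 rts1.
exists (T2 d a b), ts2; rewrite /= dq ra rb eqxx; split=> //; first by rewrite wa.
by rewrite va vb !addrA.
Qed.

(* [grow M] bounds the size of a tree of height [M]. *)
Definition grow (M : nat) : nat := if regular G then M else (2 ^ M - 1)%N.

Lemma size_tree (K : finType) (key : tree -> K) t : wf t ->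
  (forall x u, occurs x t -> below u x -> key u <> key x) ->
  (msize (vec t) <= grow #|K|)%N.
Proof.
have : forall x, occurs x t -> key x \notin (set0 : {set K}).
  by move=> x _; rewrite inE.
(* The induction is on a statement with a set [A] of keys already used above [t]; the bound becomes
   [grow] of the number of remaining keys. *)
rewrite -(cardsT K) -setC0; move: (set0).
have drop (A : {set K}) k : k \notin A -> #|~: A| = #|~: (k |: A)|.+1.
  move=> kA; rewrite (cardsD1 k (~: A)) inE kA add1n; congr _.+1.
  by apply: eq_card => y; rewrite !inE negb_or.
have child (A : {set K}) (s c : tree) : below c s ->
    (forall x, occurs x s -> key x \notin A) ->
    (forall x u, occurs x s -> below u x -> key u <> key x) ->
    (forall x, occurs x c -> key x \notin key s |: A) /\
    (forall x u, occurs x c -> below u x -> key u <> key x).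
  move=> cs nA inj.
  have xs x : occurs x c -> below x s.
    by case=> [->//|xc]; apply: below_trans xc cs.
  split=> [x /xs{}xs|x u /xs{}xs]; last by apply: inj; right.
  rewrite !inE negb_or nA ?andbT; last by right.
  by apply/eqP; apply: inj => //; left.
elim: t => [d|d a IH|d a IHa b IHb] A.
- move=> nA _ _; rewrite msize1 (drop A (key (T0 d))) /grow; last by apply: nA; left.
  by case: ifP => // _; rewrite expnS; have := expn_gt0 2 #|~: (key (T0 d) |: A)|; lia.
- set t := T1 d a => nA /andP[_ wa] inj; have kA : key t \notin A by apply: nA; left.
  have [|nAa inja] := child A t a _ nA inj; first by left.
  have := IH _ nAa wa inja; rewrite /= msizeD msize1 (drop _ _ kA) /grow.
  case: ifP => // _; rewrite expnS; have := expn_gt0 2 #|~: (key t |: A)|; lia.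
set t := T2 d a b => nA /and3P[e wa wb] inj.
have kA : key t \notin A by apply: nA; left.
have [|nAa inja] := child A t a _ nA inj; first by left; left.
have [|nAb injb] := child A t b _ nA inj; first by right; left.
have := IHa _ nAa wa inja; have := IHb _ nAb wb injb.
(* A binary node contradicts regularity, so only the exponential case remains. *)
rewrite /= !msizeD msize1 (drop _ _ kA) /grow; case: ifP => [/forallP/(_ d)|_].
  by rewrite (eqP e) msizeD !msize1.
by rewrite expnS; have := expn_gt0 2 #|~: (key t |: A)|; lia.
Qed.

End Tree.

(** * Skeletons of runs and minimal cycles *)

(** Excluded middle is used because [P] is an arbitrary predicate. *)
Lemma exists_min (T : Type) (P : T -> Prop) (f : T -> nat) x :
  P x -> exists2 y, P y & forall z, P z -> (f y <= f z)%N.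
Proof.
elim: {x}(f x).+1 {-2}x (ltnSn (f x)) => // n IH x fx Px.
have [[y [Py fy]]|no] := classic (exists y, P y /\ (f y < f x)%N).
  by apply: IH Py; lia.
exists x => // z Pz; rewrite leqNgt; apply/negP => fz.
by apply: no; exists z.
Qed.

Section Cycles.
Variables (Sigma Q : finType) (G : grammar Sigma Q).
Implicit Types (R C D F : {ffun delta G -> nat}) (s : {ffun Q -> nat}).
Implicit Type d : delta G.
Implicit Types t u x : tree G.

Definition balanced D := source D = target D.

Lemma balancedD C D : balanced C -> balanced D -> balanced (C + D).
Proof. by rewrite /balanced sourceD targetD => -> ->. Qed.

Lemma balanced_addI C D : balanced (C + D) -> balanced C -> balanced D.
Proof. by rewrite /balanced sourceD targetD => + eC; rewrite eC => /maddI. Qed.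

Lemma flow_addI F D s : flow (F + D) s -> flow F s -> balanced D.
Proof.
rewrite /flow /balanced sourceD targetD => + eF; rewrite eF => e.
by apply: (@maddI _ (target F + s)); rewrite e addrAC.
Qed.

Lemma run_tree p R : normal_form G -> run_from p R ->
  exists t, [/\ wf t, label t = p & R = vec t].
Proof.
move=> nfG /subrun_flow[fl r]; have [ts [F' [wts rts defR /(_ r) F0]]] := forest_exists nfG fl.
have [|t [ts' [wt wts' rt rts' vts]]] := @forest_pick _ _ _ ts p 0 wts.
  by rewrite addr0.
exists t; split=> //; rewrite defR F0 addr0 vts.
case: ts' {wts' vts} rts' => [|x ts']; first by rewrite /vecs big_nil addr0.
rewrite /labels big_cons => /madd_eq0[/ffunP/(_ (label x)) + _].
by rewrite msingleE eqxx m0E.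
Qed.

Lemma tree_run t : wf t -> run_from (label t) (vec t).
Proof.
move=> wt; apply/subrun_flow; split; first exact: tree_flow.
move=> q /(tree_reach wt) tq; exists (label t) => //.
by rewrite msingleE eqxx.
Qed.

(* Cutting a segment between two occurrences of a non-terminal must remove some
   non-terminal from the tree; hence the support strictly decreases between the
   two occurrences, and the pairs (non-terminal, size of the support) along a
   branch are pairwise distinct. *)
Lemma run_skeleton p R : normal_form G -> run_from p R -> exists R0 D,
  [/\ R = R0 + D, run_from p R0, rsupp R0 = rsupp R, balanced D &
      (msize R0 <= grow G (#|Q| ^ 2))%N].
Proof.
move=> nfG runR; have [t0 [wt0 rt0 defR]] := run_tree nfG runR.
pose P t := [/\ wf t, label t = p, rsupp (vec t) = rsupp R & exists D, R = vec t + D].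
have [|t [wt rt st [D defD]] tmin] := @exists_min _ P (fun t => msize (vec t)) t0.
  by split; rewrite ?defR //; exists 0; rewrite addr0.
exists (vec t), D; split=> //; first by rewrite -rt; apply: tree_run.
  apply: (@flow_addI (vec t) _ (msingle p)); last by rewrite -rt; apply: tree_flow.
  by rewrite -defD; case/subrun_flow: runR.
have Q0 : (0 < #|Q|)%N by apply/card_gt0P; exists p.
(* The support has between 1 and [#|Q|] elements; subtracting 1 gives an index in ['I_#|Q|], so the
   default value of [insubd] never occurs. *)
pose key x := (label x, insubd (Ordinal Q0) (#|rsupp (vec x)|).-1 : 'I_#|Q|).
rewrite -mulnn -{2}(card_ord #|Q|) -card_prod.
apply: (@size_tree _ _ _ _ key) => // x u xt ux [rux].
have wx : wf x by case: xt => [->//|xt]; apply: below_wf xt wt.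
have wu := below_wf ux wx.
have sgt0 (y : tree G) : (0 < #|rsupp (vec y)|)%N.
  by apply/card_gt0P; exists (label y); rewrite in_rsupp source_root.
have sle (y : tree G) : (#|rsupp (vec y)|.-1 < #|Q|)%N.
  by rewrite prednK // max_card.
move=> /(congr1 val); rewrite !val_insubd !sle => eqs.
have [w w0 vx] := below_vec ux; have [y vt] := occurs_vec xt.
have eqsupp : rsupp (vec u) = rsupp (vec x).
  apply/eqP; rewrite eqEcard vx rsuppD subsetUl -rsuppD -vx.
  by have := sgt0 u; have := sgt0 x; lia.
(* Replacing [x] by [u] keeps the support and removes the nonzero [w], against minimality of [t]. *)
have [t' [wt' rt' vt']] := graft_occurs xt wt wu rux.
have defvt' : vec t' = vec u + y.
  by apply: (@maddI _ (vec x)); rewrite addrC vt' vt addrAC addrA.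
have : (msize (vec t) <= msize (vec t'))%N.
  apply: tmin; split; rewrite ?rt' //.
    by rewrite -st defvt' vt !rsuppD eqsupp.
  by exists (w + D); rewrite defD vt defvt' vx; madd.
rewrite defvt' vt vx !msizeD.
suff : msize w != 0%N by lia.
by apply: contraNneq w0 => /msize_eq0->.
Qed.

(* As all cycles are balanced, a minimal vector that is a cycle is simple. *)
Definition minimal C :=
  [/\ C <> 0, balanced C &
      forall X Y, C = X + Y -> balanced X -> X <> 0 -> Y = 0].

(** A nonzero vector that is not minimal splits into two nonzero balanced vectors, both of smaller
    size. *)
Lemma balanced_sum D : balanced D ->
  exists2 Cs : seq {ffun delta G -> nat}, (forall i, (i < size Cs)%N -> minimal (nth 0 Cs i)) &
    D = \sum_(C <- Cs) C.
Proof.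
elim: {D}(msize D).+1 {-2}D (ltnSn (msize D)) => // n IH D Dn bD.
have [->|D0] := eqVneq D 0; first by exists [::]; rewrite ?big_nil.
have [m|nm] := classic (minimal D).
  by exists [:: D]; rewrite ?big_seq1 // => -[].
have [X [Y [defD bX X0 Y0]]] : exists X Y, [/\ D = X + Y, balanced X, X <> 0 & Y <> 0].
  apply: NNPP => no; apply: nm; split=> //; first by move/eqP: D0.
  by move=> X Y e bX X0; apply: NNPP => Y0; apply: no; exists X, Y.
have bY : balanced Y by apply: balanced_addI bX; rewrite -defD.
have pos (Z : {ffun delta G -> nat}) : Z <> 0 -> (0 < msize Z)%N.
  by move=> Z0; rewrite lt0n; apply/eqP => /msize_eq0.
have := pos X X0; have := pos Y Y0; move: Dn; rewrite defD msizeD => Dn gX gY.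
have [||Xs mXs ->] := IH X; [lia|by []|].
have [||Ys mYs ->] := IH Y; [lia|by []|].
exists (Xs ++ Ys); last by rewrite big_cat.
move=> i; rewrite size_cat nth_cat; case: (ltnP i (size Xs)) => [/mXs //|le lt].
by apply: mYs; rewrite ltn_subLR.
Qed.

(* Walking backwards along transitions of [C] eventually closes a loop [X];
   its transitions have pairwise distinct sources. *)
Lemma minimal_spine C : normal_form G -> C <> 0 -> balanced C ->
  exists E C' s p,
  [/\ C = E + C', E <> 0, target E = source E + s, (0 < source E p)%N &
   [/\ (msize E <= #|Q|)%N, (msize s <= if regular G then 0 else #|Q|)%N &
      forall q, (0 < target E q)%N -> connect (step C) p q]].
Proof.
move=> nfG C0 bC.
(* [pd] chooses a transition of [C] that produces [q]; [f] goes back to the source of that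
   transition. *)
pose pd q := [pick d | (0 < C d)%N && (0 < ttarget d q)%N].
have pdP q : q \in rsupp C -> exists d, [/\ pd q = Some d, (0 < C d)%N & (0 < ttarget d q)%N].
  rewrite in_rsupp bC => /target_gt0[d Cd dq]; rewrite /pd.
  by case: pickP => [d' /andP[]|/(_ d)]; [exists d'|rewrite Cd dq].
pose f q := if pd q is Some d then tsource d else q.
pose closed (X : {set Q}) := [&& X \subset rsupp C, X != set0 & f @: X \subset X].
have fP q : q \in rsupp C -> f q \in rsupp C.
  by move=> /pdP[d [e Cd _]]; rewrite /f e in_rsupp; apply/source_gt0; exists d.
have clC : closed (rsupp C).
  rewrite /closed subxx /=; apply/andP; split; last first.
    by apply/subsetP => _ /imsetP[q Cq ->]; apply: fP.
  have /mneq0[d Cd] : C != 0 by apply/eqP.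
  by apply/set0Pn; exists (tsource d); rewrite in_rsupp; apply/source_gt0; exists d.
(* By minimality [f] permutes [X], and every element of [X] is reachable from any other. *)
pose X := [arg min_(X < rsupp C | closed X) #|X|].
have [clX Xmin] : closed X /\ forall Y, closed Y -> Y \subset X -> Y = X.
  rewrite /X; case: arg_minnP => // Z clZ Zmin; split=> // Y clY YZ.
  by apply/eqP; rewrite eqEcard YZ Zmin.
have /and3P[XC X0 fX] := clX.
have fXX : f @: X = X.
  apply: Xmin => //; rewrite /closed (subset_trans fX XC) imsetS // andbT.
  have /set0Pn[q Xq] := X0; apply/set0Pn; exists (f q).
  exact: imset_f.
have finj : {in X &, injective f} by apply/imset_injP; rewrite fXX.
have /set0Pn[p Xp] := X0.
have Cpred q : q \in X -> step C (f q) q.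
  move=> /(subsetP XC)/pdP[d [e Cd dq]]; apply/stepP; exists d; split=> //.
  by rewrite /f e.
have conn q : q \in X -> connect (step C) p q.
  move=> Xq; suff : [set y in X | connect (step C) y q] = X.
    by move/setP/(_ p); rewrite inE Xp => /esym.
  apply: Xmin; last by apply/subsetP => y; rewrite inE => /andP[].
  apply/and3P; split.
  - by apply: (subset_trans _ XC); apply/subsetP => y; rewrite inE => /andP[].
  - by apply/set0Pn; exists q; rewrite inE Xq connect0.
  - apply/subsetP => _ /imsetP[y + ->]; rewrite !inE => /andP[Xy yq].
    rewrite (subsetP fX) ?imset_f //=.
    by apply: connect_trans yq; apply/connect1/Cpred.
pose E : {ffun delta G -> nat} := [ffun d => nat_of_bool [exists q in X, pd q == Some d]].
have EP d : (0 < E d)%N <-> exists2 q, q \in X & pd q = Some d.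
  rewrite ffunE lt0b; split=> [/exists_inP[q Xq /eqP]|[q Xq e]]; first by exists q.
  by apply/exists_inP; exists q => //; apply/eqP.
have EC d : (E d <= C d)%N.
  have [->//|/EP[q Xq e]] := posnP (E d).
  have [d' [e' Cd' _]] := pdP _ (subsetP XC _ Xq).
  by move: Cd'; rewrite e in e'; case: e' => <-; apply: leq_trans; rewrite ffunE leq_b1.
(* Injectivity of [f] on [X] makes the chosen transitions pairwise distinct, so the sum has
   coefficients 0 and 1 only. *)
have defE : E = \sum_(q in X) oapp (@msingle _) 0 (pd q).
  apply/ffunP => d; rewrite sum_ffunE.
  have [Ed|] := posnP (E d).
    rewrite Ed big1 // => q Xq; have [d' [e _ _]] := pdP _ (subsetP XC _ Xq).
    rewrite e /= msingleE; case: eqP => // dd'; suff : (0 < E d)%N by rewrite Ed.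
    by apply/EP; exists q; rewrite // dd'.
  move=> /[dup] Ed /EP[q Xq e]; rewrite (bigD1 q) //= e /= msingleE eqxx.
  rewrite big1 => [|q' /andP[Xq' qq']].
    by move: Ed; rewrite ffunE lt0b => ->.
  have [d' [e' _ _]] := pdP _ (subsetP XC _ Xq').
  rewrite e' /= msingleE; case: eqP => // dd'; case/eqP: qq'; apply: finj => //.
  by rewrite /f e e' dd'.
have sE : source E = \sum_(q in X) msingle q.
  rewrite -[in RHS]fXX big_imset //= defE.
  rewrite source_sum; apply: eq_bigr => q Xq.
  by have [d' [e' _ _]] := pdP _ (subsetP XC _ Xq); rewrite /f e' /= source1.
have sEq q : source E q = (q \in X) :> nat.
  rewrite sE sum_ffunE; have [Xq|nXq] := boolP (q \in X).
    rewrite (bigD1 q) //= msingleE eqxx big1 // => q' /andP[_].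
    by rewrite msingleE eq_sym => /negbTE->.
  rewrite big1 // => q' Xq'; rewrite msingleE; case: eqP => // qq'.
  by rewrite qq' Xq' in nXq.
have tE : target E = \sum_(q in X) oapp (@ttarget _ _ G) 0 (pd q).
  rewrite defE target_sum; apply: eq_bigr => q Xq.
  by have [d' [e' _ _]] := pdP _ (subsetP XC _ Xq); rewrite e' /= target1.
have sz : msize E = #|X|.
  rewrite -msize_source sE msize_sum -sum1_card; apply: eq_bigr => q _.
  exact: msize1.
have tge q : (source E q <= target E q)%N.
  rewrite sEq; case: (boolP (q \in X)) => //= Xq.
  rewrite tE sum_ffunE (bigD1 q) //=.
  have [d' [-> _ dq]] := pdP _ (subsetP XC _ Xq).
  by rewrite /= (leq_trans dq) // leq_addr.
(* Both truncated subtractions are exact, by [EC] and [tge]. *)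
exists E, [ffun d => C d - E d]%N, [ffun q => target E q - source E q]%N, p.
split.
- by apply/ffunP => d; rewrite maddE ffunE subnKC.
- by move=> E0; move: sz; rewrite E0 msize0 => /esym/cards0_eq; apply/eqP.
- by apply/ffunP => q; rewrite maddE ffunE subnKC.
- by rewrite sEq Xp.
split.
- by rewrite sz max_card.
- set s := finfun _; have dt : msize (target E) = (#|X| + msize s)%N.
    rewrite -sz -msize_source -msizeD; congr msize.
    by apply/ffunP => q; rewrite maddE ffunE subnKC.
  have tb : (msize (target E) <= #|X| * if regular G then 1 else 2)%N.
    rewrite tE msize_sum -sum_nat_const; apply: leq_sum => q Xq.
    have [d' [-> _ dq]] := pdP _ (subsetP XC _ Xq); rewrite /=.
    case: ifP => [/forallP/(_ d')/andP[]//|_].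
    by have /forallP/(_ d')/andP[] := nfG.
  have XQ : (#|X| <= #|Q|)%N by apply: max_card.
  rewrite -(leq_add2l #|X|) -dt (leq_trans tb) //; case: ifP => _.
    by rewrite muln1 addn0.
  by rewrite muln2 -addnn leq_add2l.
move=> q /target_gt0[d /EP[y Xy e] dq].
have [d' [e' Cd' _]] := pdP _ (subsetP XC _ Xy).
have dd' : d = d' by move: e'; rewrite e => -[].
apply: (@connect_trans _ _ (tsource d)); last first.
  by apply/connect1/stepP; exists d; split=> //; rewrite dd'.
apply: conn; have : f y \in X by apply: (subsetP fX); apply: imset_f.
by rewrite /f e.
Qed.

(** A loop of [#|Q|] transitions and [#|Q|] trees of size [2 ^ #|Q| - 1]; in the regular case there
    are no trees. *)
Definition cycle_bound : nat := if regular G then #|Q| else (#|Q| * 2 ^ #|Q|)%N.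

(** The loop of [minimal_spine] is completed by a forest for its pending non-terminals [s]. Together
    they are balanced and nonzero, hence make up all of [C]. The same argument after a cut in one
    tree shows that no label repeats along a branch. *)
Lemma minimal_cycle C : normal_form G -> minimal C ->
  (msize C <= cycle_bound)%N /\ exists2 q, q \in rsupp C & simple_cycle_from q C.
Proof.
move=> nfG [C0 bC Cmin].
have [E [C' [s [p [defC E0 tE Ep [szE szs conn]]]]]] := minimal_spine nfG C0 bC.
have fl : flow C' s.
  move: bC; rewrite /balanced /flow defC sourceD targetD tE => bC.
  by apply: (@maddI _ (source E)); rewrite bC; madd.
have bE ts : all (@wf _ _ G) ts -> labels ts = s -> balanced (E + vecs ts).
  move=> /forest_flow; rewrite /flow /balanced sourceD targetD tE => -> ->.
  by rewrite addrA addrAC.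
have nz F : E + F <> 0 by move/madd_eq0=> [].
have [ts [F' [wts rts defC' _]]] := forest_exists nfG fl.
have F0 : F' = 0.
  apply: (Cmin (E + vecs ts)) (bE _ wts rts) (nz _).
  by rewrite defC defC' addrA.
rewrite F0 addr0 in defC'.
have szt t a b : ts = a ++ t :: b -> (msize (vec t) <= grow G #|Q|)%N.
  move=> defts; move: (wts); rewrite defts all_cat /= => /and3P[wa wt wb].
  apply: (@size_tree _ _ _ _ (@label _ _ G)) => // x u xt ux rux.
  have wx : wf x by case: xt => [->//|xt]; apply: below_wf xt wt.
  have [t' [wt' rt' vt']] := graft_occurs xt wt (below_wf ux wx) rux.
  have [w w0 vx] := below_vec ux.
  have vt : vec t = vec t' + w.
    by apply: (@maddI _ (vec u)); rewrite addrC -vt' vx; madd.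
  case/eqP: w0; apply: (Cmin (E + vecs (a ++ t' :: b))); last exact: nz.
    rewrite defC defC' defts !vecs_cat !vecs_cons vt; madd.
  apply: bE; first by rewrite all_cat /= wa wt' wb.
  by rewrite -rts defts !labels_cat !labels_cons rt'.
split.
  have szts : size ts = msize s.
    rewrite -rts msize_sum; rewrite (eq_bigr (fun=> 1%N)) ?sum1_size // => t _.
    exact: msize1.
  have: (msize (vecs ts) <= size ts * grow G #|Q|)%N.
    rewrite msize_sum; elim: ts szt {wts rts defC' szts} => [|t ts IH] szt.
      by rewrite big_nil.
    rewrite big_cons mulSn leq_add //; first exact: (szt t [::] ts).
    by apply: IH => t' a b e; apply: (szt t' (t :: a) b); rewrite e.
  rewrite defC defC' msizeD szts /cycle_bound; move: szE szs; rewrite /grow.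
  case: ifP => _ szE szs le; first by move: szs le; rewrite leqn0 => /eqP->; lia.
  have : (msize s * (2 ^ #|Q| - 1) <= #|Q| * (2 ^ #|Q| - 1))%N by rewrite leq_mul2r szs orbT.
  have := expn_gt0 2 #|Q|; nia.
exists p; first by rewrite in_rsupp defC sourceD maddE ltn_addr.
split; last first.
  move=> [X [Y [X0 Y0 [p1 cX] [p2 cY] defXY]]].
  case/eqP: Y0; apply: (Cmin X) => //; last by apply/eqP.
  by apply/ffunP => q; have := cX.1 q; lia.
split=> [q|q Cq]; first by rewrite bC.
exists p; first by rewrite msingleE eqxx.
move: Cq; rewrite defC sourceD maddE addn_gt0 => /orP[Eq|].
  by rewrite -defC; apply: conn; rewrite tE maddE ltn_addr.
have sub t : (exists a b, ts = a ++ t :: b) ->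
    (0 < source (vec t) q)%N -> connect (step C) p q.
  move=> [a [b defts]] tq.
  move: (wts); rewrite defts all_cat /= => /and3P[wa wt wb].
  have [w defw] : exists w, C = vec t + w.
    exists (E + (vecs a + vecs b)).
    by rewrite defC defC' defts vecs_cat vecs_cons; madd.
  apply: (@connect_trans _ _ (label t)); last first.
    by rewrite defw; apply: connect_addl; apply: tree_reach.
  apply: conn; rewrite tE -rts defts labels_cat labels_cons !maddE msingleE eqxx.
  lia.
rewrite -defC defC'; elim: (ts) sub => [_|t l IH sub].
  by rewrite /vecs big_nil source0 m0E.
rewrite vecs_cons sourceD maddE addn_gt0 => /orP[|].
  by apply: sub; exists [::], l.
by apply: IH => t' [a [b e]]; apply: sub; exists (t :: a), b; rewrite e.
Qed.

End Cycles.

(** * Reducing integer combinations *)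

Section Relations.
Variables (Sigma I : finType) (v : I -> {ffun Sigma -> int}).
Implicit Types (n m : I -> nat) (a : I -> int).

Definition relation a := forall x, \sum_i a i * v i x = 0.

Definition comb n : {ffun Sigma -> int} := \sum_i v i *+ n i.

Definition heavy h n : {set I} := [set i | (h <= n i)%N].

Lemma combE n x : comb n x = \sum_i (n i)%:Z * v i x.
Proof.
rewrite /comb sum_ffunE; apply: eq_bigr => i _.
by rewrite ffunMnE -mulr_natl natz.
Qed.

Lemma relation_shift a n : relation a -> (forall i, a i <= (n i)%:Z) ->
  comb (fun i => absz ((n i)%:Z - a i)) = comb n.
Proof.
move=> ra an; apply/ffunP => x; rewrite !combE -[RHS]subr0 -[X in _ = _ - X](ra x) -sumrB.
by apply: eq_bigr => i _; rewrite gez0_abs ?subr_ge0 // mulrBl.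
Qed.

(** Subtracting [a] keeps [comb] and, by the bounds on [a], keeps all multiplicities nonnegative.
    Only heavy indices change, and [n i0] decreases each time, so some heavy index finally drops
    below [h]. *)
Lemma relation_reduce h n a i0 : (0 < h)%N -> relation a -> 0 < a i0 ->
  (forall i, a i != 0 -> (h <= n i)%N /\ `|a i| <= h%:Z) ->
  exists n', [/\ comb n' = comb n, (forall i, (0 < n' i)%N -> (0 < n i)%N) &
    (#|heavy h n'| < #|heavy h n|)%N].
Proof.
move=> h0 ra ai0; elim: {n}(n i0).+1 {-2}n (ltnSn (n i0)) => // k IH n nk an.
pose n1 i := absz ((n i)%:Z - a i).
have le i : a i <= (n i)%:Z.
  have [->//|/an[hn ha]] := eqVneq (a i) 0; lia.
have same i : a i = 0 -> n1 i = n i by rewrite /n1 => ->; lia.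
have sub : heavy h n1 \subset heavy h n.
  apply/subsetP => i; rewrite !inE; have [/same->//|/an[]//] := eqVneq (a i) 0.
have pos i : (0 < n1 i)%N -> (0 < n i)%N.
  by have [/same->//|/an[hn _] _] := eqVneq (a i) 0; apply: leq_trans hn.
have c1 : comb n1 = comb n by apply: relation_shift.
have [eqh|neqh] := eqVneq (heavy h n1) (heavy h n); last first.
  by exists n1; split=> //; apply: proper_card; rewrite properEneq neqh.
have [||n' [c' p' h']] := IH n1.
- by have := le i0; rewrite /n1; lia.
- move=> i /[dup] ai0' /an[hn ha]; split=> //.
  by have : i \in heavy h n1 by [rewrite eqh inE]; rewrite inE.
by exists n'; split; rewrite ?c' -?eqh // => i /p'/pos.
Qed.

(** Used with [h = 1], where it bounds the support, and with [h = HA #|Sigma| S], where it gives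
    linear independence on the heavy indices. *)
Definition relation_free h n := forall a, relation a ->
  (forall i, a i != 0 -> (h <= n i)%N /\ `|a i| <= h%:Z) -> forall i, a i = 0.

(** A choice of multiplicities with the fewest heavy indices works: a forbidden relation has, up to
    sign, a positive coefficient, and [relation_reduce] would lower that number. *)
Lemma relation_elim h n : (0 < h)%N -> exists n', [/\ comb n' = comb n,
  (forall i, (0 < n' i)%N -> (0 < n i)%N) & relation_free h n'].
Proof.
move=> h0; pose P m := comb m = comb n /\ (forall i, (0 < m i)%N -> (0 < n i)%N).
have [//|m [cm sm] mmin] := @exists_min _ P (fun m => #|heavy h m|) n.
exists m; split=> // a ra ha i; apply/eqP/negPn/negP => ai.
have [b [rb bi hb]] : exists b, [/\ relation b, 0 < b i &
    forall j, b j != 0 -> (h <= m j)%N /\ `|b j| <= h%:Z].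
  have [ai0|ai0] := ltP 0 (a i); first by exists a.
  exists (fun j => - a j); split=> [x||j]; last by rewrite oppr_eq0 normrN; apply: ha.
    rewrite (eq_bigr (fun j => - (a j * v j x))) => [|j _]; last by rewrite mulNr.
    by rewrite sumrN ra oppr0.
  by rewrite oppr_gt0 lt_neqAle ai.
have [m' [cm' sm' hm']] := relation_reduce h0 rb bi hb.
have : P m' by split=> [|j /sm'/sm]; rewrite ?cm'.
by move/mmin; rewrite leqNgt hm'.
Qed.

(* Two subsets of the support with the same sum differ by a relation with
   coefficients in {-1, 0, 1}. *)
Lemma relation_free_support S n : (forall i x, (absz (v i x) <= S)%N) ->
  relation_free 1 n ->
  (2 ^ #|heavy 1 n| <= (2 * #|heavy 1 n| * S + 1) ^ #|Sigma|)%N.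
Proof.
move=> vS fn; set K := #|_|; set b := (2 * K * S + 1)%N.
pose sm (X : {set I}) x := \sum_(i in X) v i x.
(* The sums over subsets of the support lie between [- K * S] and [K * S], so that after the shift
   neither [absz] nor [inord] loses information. *)
pose f (X : {set I}) : {ffun Sigma -> 'I_(2 * K * S).+1} :=
  [ffun x => inord (absz (sm X x + (K * S)%N%:Z))].
have smS (X : {set I}) x : X \subset heavy 1 n -> `|sm X x| <= (K * S)%N%:Z.
  move=> XK; apply: le_trans (ler_norm_sum _ _ _) _.
  apply: le_trans (_ : \sum_(i in X) S%:Z <= _).
    by apply: ler_sum => i _; have := vS i x; lia.
  rewrite sumr_const -mulr_natl natz -PoszM lez_nat leq_mul2r.
  by rewrite (subset_leq_card XK) orbT.
rewrite leqNgt; apply/negP => big.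
have /dinjectivePn[X XP [Y /andP[YX YP] fXY]] : ~~ dinjectiveb f (powerset (heavy 1 n)).
  apply: contraL big => /dinjectiveP/card_in_imset inj.
  rewrite -leqNgt -(card_powerset (heavy 1 n)) -inj.
  by rewrite /b addn1 -[X in (_ <= X ^ _)%N]card_ord -card_ffun max_card.
rewrite !powersetE in XP YP.
pose a i : int := (i \in X)%:Z - (i \in Y)%:Z.
have indic (Z : {set I}) x : \sum_i (i \in Z)%:Z * v i x = sm Z x.
  rewrite /sm [RHS]big_mkcond; apply: eq_bigr => i _.
  by case: (i \in Z); rewrite ?mul1r ?mul0r.
have ra : relation a.
  move=> x; rewrite (eq_bigr (fun i => (i \in X)%:Z * v i x - (i \in Y)%:Z * v i x)).
    rewrite sumrB !indic; move/ffunP/(_ x)/(congr1 val): fXY.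
    by rewrite !ffunE /= !inordK; have := smS X x XP; have := smS Y x YP; lia.
  by move=> i _; rewrite mulrBl.
have /fn a0 : forall i, a i != 0 -> (1 <= n i)%N /\ `|a i| <= 1%:Z.
  move=> i; rewrite /a; have := subsetP XP i; have := subsetP YP i; rewrite !inE.
  by case: (i \in X); case: (i \in Y) => // pY pX _; split=> //; [apply: pX|apply: pY].
case/eqP: YX; apply/setP => i; have := a0 ra i; rewrite /a.
by case: (i \in X); case: (i \in Y).
Qed.

End Relations.

(** * Determinants and integer relations with small coefficients *)

Lemma det_bound r (M : 'M[int]_r) S : (forall i j, (absz (M i j) <= S)%N) ->
  (absz (\det M) <= r`! * S ^ r)%N.
Proof.
move=> MS; rewrite -lez_nat abszE.
apply: le_trans (ler_norm_sum _ _ _) _.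
(* The Leibniz formula has [r!] terms, each of absolute value at most [S ^ r]. *)
apply: le_trans (_ : \sum_(s : 'S_r) (S ^ r)%N%:Z <= _); last first.
  by rewrite sumr_const card_Sn -mulr_natl natz -PoszM.
apply: ler_sum => s _; rewrite normrM normr_sign mul1r normr_prod.
apply: le_trans (_ : \prod_(i < r) S%:Z <= _).
  by apply: ler_prod => i _; rewrite normr_ge0 /=; have := MS i (s i); lia.
by rewrite prodr_const card_ord -[Posz S]natz -natrX natz.
Qed.

Section Minors.
Variables (Sigma : finType) (k : nat) (v : 'I_k -> {ffun Sigma -> int}).

Definition minor_mx r (f : 'I_r -> 'I_k) (g : 'I_r -> Sigma) : 'M[int]_r :=
  \matrix_(i, j) v (f i) (g j).

Lemma minor_injl r (f : 'I_r -> 'I_k) g : \det (minor_mx f g) != 0 -> injective f.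
Proof.
move=> d0 i j fij; apply/eqP; apply: contraR d0 => ij; apply/eqP.
by apply: (determinant_alternate ij) => l; rewrite !mxE fij.
Qed.

Lemma minor_injr r (f : 'I_r -> 'I_k) g : \det (minor_mx f g) != 0 -> injective g.
Proof.
move=> d0 i j gij; apply/eqP; apply: contraR d0 => ij; apply/eqP.
rewrite -det_tr; apply: (determinant_alternate ij) => l.
by rewrite !mxE gij.
Qed.

(** The row choice [f] is injective, hence a permutation of ['I_k]; a rational relation becomes a
    row vector killed by an invertible matrix. *)
Lemma minor_free (f : 'I_k -> 'I_k) g : \det (minor_mx f g) != 0 -> lin_indep v.
Proof.
move=> d0; have fI := minor_injl d0.
rewrite /lin_indep -val_ord_tuple.
rewrite -[map _ _]/(tval (map_tuple (fun i => ratvec (v i)) (ord_tuple k))).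
apply/freeP => c c0.
pose u : 'rV[rat]_k := \row_i c (f i).
pose M : 'M[rat]_k := map_mx intr (minor_mx f g).
have uM : u *m M = 0.
  apply/rowP => j; rewrite !mxE; move/ffunP: c0 => /(_ (g j)).
  rewrite sum_ffunE ffunE => e.
  rewrite -[RHS]e [RHS](reindex f); last exact/onW_bij/injF_bij.
  apply: eq_bigr => i _.
  by rewrite !mxE ffunE -tnth_nth tnth_map tnth_ord_tuple ffunE.
have Mu : M \in unitmx by rewrite unitmxE det_map_mx unitfE intr_eq0.
have u0 : u = 0 by rewrite -[u](mulmxK Mu) uM mul0mx.
move=> i; have [f' fK f'K] := injF_bij fI; rewrite -(f'K i).
by move/rowP: u0 => /(_ (f' i)); rewrite !mxE.
Qed.

(* Cramer's rule: extending a nonzero minor of maximal size by one row and any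
   column gives a vanishing determinant, whose cofactors along the new column do
   not depend on that column. *)
Lemma lin_indep_or_relation S : (0 < S)%N -> (forall i x, (absz (v i x) <= S)%N) ->
  lin_indep v \/ exists a, [/\ relation v a, exists i, a i != 0 &
    forall i, (absz (a i) <= HA #|Sigma| S)%N].
Proof.
move=> S0 vS.
pose P r := [exists f : {ffun 'I_r -> 'I_k}, exists g : {ffun 'I_r -> Sigma},
  \det (minor_mx f g) != 0].
have exP : exists r, P r.
  exists 0%N; apply/existsP; exists (ffun0 (card_ord 0)).
  apply/existsP; exists (ffun0 (card_ord 0)).
  by rewrite det_mx00 oner_neq0.
have ubP r : P r -> (r <= k)%N.
  case/existsP=> f /existsP[g /minor_injl fI].
  by have := leq_card _ fI; rewrite !card_ord.
case: (ex_maxnP exP ubP) => r /existsP[f /existsP[g d0]] rmax.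
have rA : (r <= #|Sigma|)%N.
  by have := leq_card _ (minor_injr d0); rewrite card_ord.
have := ubP r (introT existsP (ex_intro _ f (introT existsP (ex_intro _ g d0)))).
rewrite leq_eqVlt => /orP[/eqP rk|rk].
  by left; subst r; apply: minor_free d0.
right.
have [i0 i0f] : exists i0, i0 \notin codom f.
  apply/existsP; rewrite -negb_forall; apply/negP => /forallP all.
  have : (#|'I_k| <= #|codom f|)%N.
    by apply/subset_leq_card/subsetP => i _; apply: all.
  by rewrite (card_codom (minor_injl d0)) !card_ord leqNgt rk.
(* The added row gets index 0, and so does the added column in [g1] below. *)
pose f1 i := if unlift ord0 i is Some j then f j else i0.
have f1I : injective f1.
  move=> i j; rewrite /f1; case: unliftP => [i' ->|->]; case: unliftP => [j' ->|->] //.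
  - by move/(minor_injl d0) ->.
  - by move=> e; case/negP: i0f; rewrite -e codom_f.
  - by move=> e; case/negP: i0f; rewrite e codom_f.
pose c (i : 'I_r.+1) := (-1) ^+ i * \det (minor_mx (f1 \o lift i) g).
have rel x : \sum_i c i * v (f1 i) x = 0.
  pose g1 j := if unlift ord0 j is Some j' then g j' else x.
  have : \det (minor_mx (finfun f1) (finfun g1)) = 0.
    apply/eqP/negPn/negP => d1; have := rmax r.+1; rewrite ltnn => /(_ _)/notF; apply.
    by apply/existsP; exists (finfun f1); apply/existsP; exists (finfun g1).
  rewrite (expand_det_col _ ord0) => e; rewrite -[RHS]e; apply: eq_bigr => i _.
  have g10 : g1 ord0 = x by rewrite /g1 unlift_none.
  rewrite mxE !ffunE g10 mulrC; congr (_ * _).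
  rewrite /cofactor addn0; congr (_ * \det _); apply/matrixP => p q.
  by rewrite !mxE !ffunE /g1 liftK.
(* [c] is carried over to ['I_k], with value zero outside the image of [f1]. *)
pose a y := \sum_(i | f1 i == y) c i.
have af i : a (f1 i) = c i.
  by rewrite /a (big_pred1 i) // => j; rewrite (inj_eq f1I).
exists a; split.
- move=> x; rewrite -[RHS](rel x) [RHS](partition_big f1 predT) //=.
  apply: eq_bigr => y _; rewrite mulr_suml.
  by apply: eq_bigr => i /eqP->.
(* The coefficient of the added row is the original nonzero minor. *)
- exists (f1 ord0); rewrite af /c expr0 mul1r; congr (\det _ != 0): d0.
  by apply/matrixP => p q; rewrite !mxE /= /f1 liftK.
move=> y; have [/existsP[i /eqP<-]|/existsPn no] := boolP [exists i, f1 i == y]; last first.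
  by rewrite /a big_pred0 // => i; apply/negbTE.
rewrite af /c abszM abszX.
have -> : absz (-1) = 1%N by [].
rewrite exp1n mul1n; apply: leq_trans (det_bound (S := S) _) _ => [p q|].
  by rewrite mxE.
by rewrite /HA leq_mul ?leq_pexp2l ?leq_fact.
Qed.

End Minors.

(** Elimination with threshold 1 leaves [K] nonzero multiplicities; elimination with threshold
    [HA #|Sigma| S] then creates no new ones. [J] collects the indices that reach the second
    threshold, and the others are at most [K] nonzero multiplicities below it. *)
Lemma comb_reduce (Sigma I : finType) (v : I -> {ffun Sigma -> int}) S (n : I -> nat) :
  (0 < S)%N -> (forall i x, (absz (v i x) <= S)%N) ->
  exists (n' : I -> nat) (J : {set I}) K,
  [/\ comb v n' = comb v n, lin_indep (fun j : 'I_#|J| => v (enum_val j)),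
      (\sum_(i in ~: J) n' i <= K * HA #|Sigma| S)%N &
      (2 ^ K <= (2 * K * S + 1) ^ #|Sigma|)%N].
Proof.
move=> S0 vS; have [n1 [c1 s1 f1]] := relation_elim v n (ltn0Sn 0).
have h0 : (0 < HA #|Sigma| S)%N by rewrite muln_gt0 fact_gt0 expn_gt0 S0.
have [n2 [c2 s2 f2]] := relation_elim v n1 h0.
exists n2, (heavy (HA #|Sigma| S) n2), #|heavy 1 n1|; split.
- by rewrite c2.
- set J := heavy _ _.
  have [//|[a [ra [i ai] ha]]] :=
    @lin_indep_or_relation _ _ (fun j : 'I_#|J| => v (enum_val j)) S S0 (fun _ => vS _).
  (* [b] extends the relation [a] by zero outside [J], so that [f2] applies. *)
  pose b y := \sum_(i | enum_val i == y) a i.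
  have bE j : b (enum_val j) = a j.
    by rewrite /b (big_pred1 j) // => l; rewrite (inj_eq enum_val_inj).
  case/eqP: ai; rewrite -bE; apply: f2 => [x|y].
    rewrite -[RHS](ra x) [RHS](partition_big enum_val predT) //=.
    by apply: eq_bigr => y _; rewrite mulr_suml; apply: eq_bigr => l /eqP->.
  have [/existsP[j /eqP<-]|/existsPn no] := boolP [exists j : 'I_#|J|, enum_val j == y].
    by rewrite bE => _; have := enum_valP j; rewrite inE; split=> //; have := ha j; lia.
  by rewrite /b big_pred0 ?eqxx // => j; apply/negbTE.
- rewrite -sum_nat_const [leqRHS]big_mkcond /= [leqLHS]big_mkcond /=.
  apply: leq_sum => i _; rewrite !inE -ltnNge; case: ltnP => // lt.
  case: ifP => [_|]; first exact: ltnW.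
  by move/negbT; rewrite -eqn0Ngt => n10; have [->|/s2] := posnP (n2 i); rewrite ?(eqP n10).
exact: relation_free_support vS f1.
Qed.

(** * The decomposition *)

Section Assembly.
Variables (Sigma Q : finType) (G : grammar Sigma Q).
Implicit Types (R C D : {ffun delta G -> nat}).

Lemma Psi_bound R x : normal_form G -> (absz (Psi R x) <= msize R)%N.
Proof.
move=> /forallP nf; rewrite /Psi sum_ffunE -lez_nat abszE.
apply: le_trans (ler_norm_sum _ _ _) _.
rewrite /msize -[Posz _]natz natr_sum; apply: ler_sum => d _.
rewrite natz ffunMnE normrMn -mulr_natl natz -[leRHS]mulr1 ler_wpM2l //.
have /andP[_] := nf d; apply: leq_trans; rewrite /norm1 (bigD1 x) //=.
exact: leq_addr.
Qed.

Lemma PsiMn R n : Psi (R *+ n) = Psi R *+ n.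
Proof. by elim: n => [|n IH]; rewrite ?mulr0n ?Psi0 // !mulrS PsiD IH. Qed.

(** A balanced vector does not affect the balance equation, and its sources are already reached by
    the steps of [R]. *)
Lemma run_addr p R D : run_from p R -> balanced D -> rsupp D \subset rsupp R ->
  run_from p (R + D).
Proof.
case/subrun_flow=> fl r bD DR; apply/subrun_flow; split.
  by rewrite /flow sourceD targetD fl -bD addrAC.
move=> q; rewrite -in_rsupp rsuppD inE => Rq.
have /r[c pc cq] : (0 < source R q)%N.
  by rewrite -in_rsupp; case/orP: Rq => // /(subsetP DR).
by exists c => //; apply: connect_addl.
Qed.

Lemma bound_ge K : (0 < #|Q|)%N ->
  (2 ^ K <= (2 * K * cycle_bound G + 1) ^ #|Sigma|)%N ->
  (grow G (#|Q| ^ 2) + cycle_bound G * (K * HA #|Sigma| (cycle_bound G)) <= bound G)%N.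
Proof.
move=> Q0 le; rewrite /bound leq_add //.
  by rewrite /grow /Gamma; case: ifP => _; rewrite ?leq_addr // expnD; lia.
(* Taking out the factorial leaves the quantity that the pigeonhole bounds control. *)
have -> : (cycle_bound G * (K * HA #|Sigma| (cycle_bound G)) =
    (#|Sigma|)`! * (K * cycle_bound G ^ (#|Sigma|).+1))%N.
  by rewrite /HA expnS; lia.
rewrite add1n /HA [leqRHS]mulnCA leq_mul2l; apply/orP; right.
move: le; rewrite /cycle_bound /Gamma; case: ifP => _.
  exact: pigeonhole_bound_regular.
exact: pigeonhole_bound.
Qed.

End Assembly.

Theorem theorem2p13 (Sigma Q : finType) (G : grammar Sigma Q)
    (R : {ffun delta G -> nat}) :
  normal_form G ->
  run_from (initial G) R ->
  exists (R1 : {ffun delta G -> nat}) (m : nat)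
         (C : 'I_m -> {ffun delta G -> nat}) (n : 'I_m -> nat),
    [/\ run_from (initial G) R1,
        Psi R = Psi R1 + \sum_(k < m) Psi (C k) *+ n k,
        (msize R1 <= bound G)%N,
        forall k, exists2 q, q \in rsupp R1 & simple_cycle_from q (C k)
      & lin_indep (fun k => Psi (C k))].
Proof.
move=> nf runR; have Q0 : (0 < #|Q|)%N by apply/card_gt0P; exists (initial G).
have [R0 [D [defR run0 supp0 bD szR0]]] := run_skeleton nf runR.
have [Cs mCs defD] := balanced_sum bD.
pose c (i : 'I_(size Cs)) := nth 0 Cs i.
have cP i : minimal (c i) by apply: mCs.
have {}defD : D = \sum_i c i by rewrite defD (big_nth 0) big_mkord.
(* Each [c i] is a part of [R], and [R0] has the support of [R]. *)
have csupp i : rsupp (c i) \subset rsupp R0.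
  rewrite supp0 defR defD (bigD1 i) //= !rsuppD setUCA.
  exact: subsetUl.
have S0 : (0 < cycle_bound G)%N.
  by rewrite /cycle_bound; case: ifP; rewrite ?muln_gt0 ?expn_gt0 Q0.
have vS i x : (absz (Psi (c i) x) <= cycle_bound G)%N.
  by apply: leq_trans (Psi_bound _ _ nf) _; have [] := minimal_cycle nf (cP i).
(* The indices are the positions in [Cs], so every cycle starts with multiplicity 1, even one that
   is listed repeatedly. *)
have [n [J [K [cn Jfree szn K2]]]] := comb_reduce (fun=> 1%N) S0 vS.
pose E := \sum_(i in ~: J) c i *+ n i.
pose good (X : {ffun delta G -> nat}) := balanced X /\ rsupp X \subset rsupp R0.
have good0 : good 0.
  split; first by rewrite /balanced source0 target0.
  by apply/subsetP => q; rewrite in_rsupp source0 m0E.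
have goodD X Y : good X -> good Y -> good (X + Y).
  by move=> [bX sX] [bY sY]; split; [apply: balancedD|rewrite rsuppD subUset sX].
have goodc i : good (c i *+ n i).
  elim: (n i) => [//|k IH]; rewrite mulrS; apply: goodD => //.
  by split=> //; have [] := cP i.
have [bE Esupp] : good E by exact: (big_ind good good0 goodD (fun i _ => goodc i)).
exists (R0 + E), #|J|, (c \o enum_val), (n \o enum_val); split=> //.
- exact: run_addr.
- have -> : Psi R = Psi R0 + comb (fun i => Psi (c i)) n.
    by rewrite cn defR defD PsiD Psi_sum.
  rewrite PsiD Psi_sum -addrA; congr (_ + _).
  rewrite /comb (bigID [in ~: J]) /=; congr (_ + _).
    by apply: eq_bigr => i _; rewrite PsiMn.
  rewrite (eq_bigl [in J]) => [|i]; last by rewrite inE negbK.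
  exact: (big_enum_val (fun i => Psi (c i) *+ n i)).
- apply: leq_trans (bound_ge Q0 K2); rewrite msizeD leq_add //.
  apply: leq_trans (leq_mul (leqnn _) szn); rewrite msize_sum big_distrr /=.
  apply: leq_sum => i _; rewrite msizeMn leq_mul //.
  by have [] := minimal_cycle nf (cP i).
move=> k; have [_ [q cq sq]] := minimal_cycle nf (cP (enum_val k)).
by exists q => //; rewrite rsuppD inE (subsetP (csupp _) _ cq).
Qed.
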